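(* Let $A$ be a Banach algebra with a contractive approximate identity, and let $\pi\colon A\to\mathcal{L}(E)$ be an isometric nondegenerate representation of $A$ on a Banach space $E$. Then the Banach algebra $M(A)$ is isometrically isomorphic to $$\{t\in\mathcal{L}(E) : t\pi(A)\subseteq\pi(A),\ \pi(A)t\subseteq\pi(A)\},$$ the algebra of two-sided multipliers of $\pi(A)$, via the map $\widehat{\pi}\colon M(A)\to\mathcal{L}(E)$, where $\widehat{\pi}$ is the unique nondegenerate, contractive and unital representation of $M(A)$ on $E$ satisfying $\widehat{\pi}\circ\iota_A=\pi$.
   Context: For a Banach space $E$, $\mathcal{L}(E)$ is the Banach algebra of bounded linear maps $E\to E$. A representation of a Banach algebra $A$ on $E$ is a continuous algebra homomorphism $\pi\colon A\to\mathcal{L}(E)$; it is contractive if $\|\pi(a)\|\le\|a\|$ for all $a$, isometric if $\|\pi(a)\|=\|a\|$ for all $a$, and nondegenerate if $\operatorname{span}\{\pi(a)\xi : a\in A,\xi\in E\}$ is dense in $E$. A contractive approximate identity of $A$ is a net $(e_\lambda)_{\lambda\in\Lambda}$ in $A$ with $\|e_\lambda\|\le1$ for all $\lambda$ and $\lim_\lambda\|ae_\lambda-a\|=\lim_\lambda\|e_\lambda a-a\|=0$ for all $a\in A$. $M(A)$ is the set of pairs $(L,R)$ with $L,R\in\mathcal{L}(A)$ such that $L(ab)=L(a)b$, $R(ab)=aR(b)$ and $aL(b)=R(a)b$ for all $a,b\in A$, with product $(L,R)(L',R')=(LL',R'R)$, unit $(\mathrm{id}_A,\mathrm{id}_A)$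 and norm $\|(L,R)\|=\max\{\|L\|,\|R\|\}$. The map $\iota_A\colon A\to M(A)$ is $\iota_A(a)=(L_a,R_a)$, where $L_a(b)=ab$, $R_a(b)=ba$. It is a known result that, for $A$ with a contractive approximate identity and $\pi$ a contractive nondegenerate representation on $E$, there is a unique nondegenerate, contractive, unital representation $\widehat{\pi}\colon M(A)\to\mathcal{L}(E)$ with $\pi=\widehat{\pi}\circ\iota_A$, and that $\widehat{\pi}$ is isometric when $\pi$ is. *)

(* Defs.v *)
From HB Require Import structures.
From mathcomp Require Import all_boot all_order all_algebra complex.
From mathcomp Require Import all_classical all_reals all_analysis.

Set Implicit Arguments.
Unset Strict Implicit.
Unset Printing Implicit Defensive.

Import Order.TTheory GRing.Theory Num.Theory.
Import numFieldNormedType.Exports.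

Local Open Scope classical_set_scope.
Local Open Scope ring_scope.

(* The scalars of the Banach spaces below: a field with absolute value whose
   cone of nonnegative elements has infima. By the Ostrowski and Gelfand-Mazur
   theorems these are the real and the complex numbers, packed as real_scalars
   and complex_scalars. *)
HB.mixin Record NumField_isRealOrComplex K & Num.NumField K := {
  nneg_inf_subproof : forall S : set K, S !=set0 -> (forall x, S x -> 0 <= x) ->
    exists m : K, (forall x, S x -> m <= x) /\
      (forall m', (forall x, S x -> m' <= x) -> m' <= m)
}.

#[short(type="realOrComplexType")]
HB.structure Definition RealOrComplex :=
  {K of Num.NumField K & NumField_isRealOrComplex K}.

Section scalar_instances.
Variable R : realType.

Lemma real_nneg_inf (S : set R) : S !=set0 -> (forall x, S x -> 0 <= x) ->
  exists m : R, (forall x, S x -> m <= x) /\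
    (forall m', (forall x, S x -> m' <= x) -> m' <= m).
Proof.
move=> S0 Sge0; have hS : has_inf S by split => //; exists 0 => x /Sge0.
exists (inf S); split=> [x Sx|m' lem'].
  by apply: ge_inf => //; case: hS.
by apply: lb_le_inf => // x /lem'.
Qed.

Definition real_scalars : realOrComplexType :=
  HB.pack (Real.sort R) (NumField_isRealOrComplex.Build R real_nneg_inf).

Lemma complex_nneg_inf (S : set R[i]) :
  S !=set0 -> (forall x, S x -> 0 <= x) ->
  exists m : R[i], (forall x, S x -> m <= x) /\
    (forall m', (forall x, S x -> m' <= x) -> m' <= m).
Proof.
move=> [x0 Sx0] Sge0.
have S'0 : (@complex.Re R @` S) !=set0 by exists (complex.Re x0), x0.
have S'ge0 r : (@complex.Re R @` S) r -> 0 <= r.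
  by move=> [x /Sge0 + <-]; rewrite lecE => /andP[].
have [m [mS mlub]] := real_nneg_inf S'0 S'ge0.
exists (Complex m 0); split=> [x Sx|m' lem'].
  have := Sge0 _ Sx; rewrite !lecE /= => /andP[-> _] /=.
  by apply: mS; exists x.
have := lem' _ Sx0; have := Sge0 _ Sx0.
rewrite !lecE /= => /andP[/eqP Imx0 _] /andP[Imm' _].
rewrite eq_sym -Imx0 eq_sym Imm' /=; apply: mlub => _ [x Sx <-].
by have := lem' _ Sx; rewrite lecE => /andP[].
Qed.

Definition complex_scalars : realOrComplexType :=
  HB.pack (complex R) (NumField_isRealOrComplex.Build R[i] complex_nneg_inf).

End scalar_instances.

(* Banach algebras need not have a unit, so the ring structures of the library
   do not apply. *)
HB.mixin Record CompleteNormedModule_isBanachAlgebra (K : numFieldType) A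
    & CompleteNormedModule K A := {
  bmul : A -> A -> A;
  bmulA : associative bmul;
  bmulDl : left_distributive bmul +%R;
  bmulDr : right_distributive bmul +%R;
  bmulZl : forall (k : K) (a b : A), bmul (k *: a) b = k *: bmul a b;
  bmulZr : forall (k : K) (a b : A), bmul a (k *: b) = k *: bmul a b;
  ler_norm_bmul : forall a b : A, `|bmul a b| <= `|a| * `|b|
}.

#[short(type="banachAlgType")]
HB.structure Definition BanachAlgebra (K : numFieldType) :=
  {A of CompleteNormedModule K A & CompleteNormedModule_isBanachAlgebra K A}.

Notation "a ** b" := (bmul a b) (at level 40, left associativity) : ring_scope.


Section Lipschitz.
Variables (K : numFieldType) (V W : normedModType K) (phi : V -> W) (c : K).
Hypothesis c_ge0 : 0 <= c.
Hypothesis phi_lip : forall u v, `|phi u - phi v| <= c * `|u - v|.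

Let phi_lt e u v : 0 < e -> `|u - v| < e / (c + 1) -> `|phi u - phi v| < e.
Proof.
have c1 : 0 < c + 1 by rewrite ltr_wpDl.
move=> e0; rewrite ltr_pdivlMr// => uve.
rewrite (le_lt_trans (phi_lip _ _))// (le_lt_trans _ uve)// mulrC.
by rewrite ler_wpM2l// lerDl.
Qed.

Lemma lip_cvg (I : Type) (F : set_system I) (f : I -> V) (l : V) :
  Filter F -> f @ F --> l -> phi (f i) @[i --> F] --> phi l.
Proof.
move=> FF fl; apply/cvgrPdist_lt => e e0.
have e1 : 0 < e / (c + 1) by rewrite divr_gt0// ltr_wpDl.
move/cvgrPdist_lt : fl => /(_ _ e1); apply: filterS => i.
exact: phi_lt.
Qed.

Lemma lip_cauchy (F : set_system V) :
  ProperFilter F -> cauchy F -> cauchy (phi @ F).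
Proof.
move=> FF /cauchyP Fc; apply/cauchyP => e e0.
have [|v Fv] := Fc (e / (c + 1)); first by rewrite divr_gt0// ltr_wpDl.
exists (phi v).
suff : F [set u | `|phi v - phi u| < e] by rewrite -ball_normE.
apply: filterS Fv => u; rewrite -ball_normE; exact: phi_lt.
Qed.

End Lipschitz.

Section BoundedOperators.
Variables (K : realOrComplexType) (E : completeNormedModType K).

Record boundedOp := BoundedOp {
  op_fun :> E -> E;
  op_linear : linear op_fun;
  op_bounded : exists c : K, forall x, `|op_fun x| <= c * `|x|
}.

HB.instance Definition _ := gen_eqMixin boundedOp.
HB.instance Definition _ := gen_choiceMixin boundedOp.

Implicit Types s t u : boundedOp.

Lemma boundedOpP s t : (forall x, s x = t x) -> s = t.
Proof.
case: s => s ls bs; case: t => t lt bt /= /funext st.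
by move: ls bs; rewrite st => ls bs; congr BoundedOp; exact: Prop_irrelevance.
Qed.

Lemma opP t (k : K) x y : t (k *: x + y) = k *: t x + t y.
Proof. exact: op_linear. Qed.

Lemma opD t x y : t (x + y) = t x + t y.
Proof. by rewrite -[x]scale1r opP !scale1r. Qed.

Lemma op0 t : t 0 = 0.
Proof. by apply: (addrI (t 0)); rewrite -opD !addr0. Qed.

Lemma opZ t (k : K) x : t (k *: x) = k *: t x.
Proof. by rewrite -[k *: x]addr0 opP op0 addr0. Qed.

Lemma opB t x y : t (x - y) = t x - t y.
Proof. by rewrite -scaleN1r opD opZ scaleN1r. Qed.

Definition op_bounds t : set K :=
  [set c | 0 <= c /\ forall x, `|t x| <= c * `|x|].

(* The least bound, which exists by opnormP. *)
Definition opnorm t : K :=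
  xget 0 [set m | op_bounds t m /\ forall c, op_bounds t c -> m <= c].

Lemma op_bounds_neq0 t : op_bounds t !=set0.
Proof.
have [c tc] := op_bounded t; exists `|c|; split=> // x.
have := tc x; have [->|x0] := eqVneq x 0; first by rewrite op0 !normr0 !mulr0.
move=> le_c; have c0 : 0 <= c.
  by rewrite -(pmulr_lge0 c (_ : 0 < `|x|)) ?normr_gt0// (le_trans _ le_c).
by rewrite ger0_norm.
Qed.

Lemma opnormP t :
  op_bounds t (opnorm t) /\ forall c, op_bounds t c -> opnorm t <= c.
Proof.
have [||m [lem mle]] := @nneg_inf_subproof K (op_bounds t).
- exact: op_bounds_neq0.
- by move=> c [].
have m_least : op_bounds t m /\ forall c, op_bounds t c -> m <= c.
  split=> //; split=> [|x]; first by apply: mle => c [].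
  have [->|x0] := eqVneq x 0; first by rewrite op0 !normr0 mulr0.
  rewrite -ler_pdivrMr ?normr_gt0//; apply: mle => c [_ tc].
  by rewrite ler_pdivrMr ?normr_gt0.
apply: (@xgetPex _ 0
  [set m | op_bounds t m /\ forall c, op_bounds t c -> m <= c]).
by exists m.
Qed.

Lemma opnorm_ge0 t : 0 <= opnorm t.
Proof. by have [[]] := opnormP t. Qed.

Lemma ler_opnorm t x : `|t x| <= opnorm t * `|x|.
Proof. by have [[_]] := opnormP t. Qed.

Lemma opnorm_le t c : 0 <= c -> (forall x, `|t x| <= c * `|x|) -> opnorm t <= c.
Proof. by move=> c0 tc; have [_] := opnormP t; apply. Qed.

Program Definition op_zero := @BoundedOp (fun=> 0) _ _.
Next Obligation. by move=> k x y; rewrite scaler0 addr0. Qed.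
Next Obligation. by exists 0 => x; rewrite normr0 mul0r. Qed.

Program Definition op_opp t := @BoundedOp (fun x => - t x) _ _.
Next Obligation. by move=> t k x y; rewrite opP opprD scalerN. Qed.
Next Obligation. by move=> t; exists (opnorm t) => x; rewrite normrN ler_opnorm. Qed.

Program Definition op_add s t := @BoundedOp (fun x => s x + t x) _ _.
Next Obligation. by move=> s t k x y; rewrite !opP scalerDr addrACA. Qed.
Next Obligation.
move=> s t; exists (opnorm s + opnorm t) => x.
by rewrite mulrDl (le_trans (ler_normD _ _))// lerD// ler_opnorm.
Qed.

Program Definition op_scale (k : K) t := @BoundedOp (fun x => k *: t x) _ _.
Next Obligation.
by move=> k t l x y; rewrite opP scalerDr !scalerA mulrC.
Qed.
Next Obligation.
move=> k t; exists (`|k| * opnorm t) => x.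
by rewrite normrZ -mulrA ler_wpM2l// ler_opnorm.
Qed.

Program Definition op_comp s t := @BoundedOp (s \o t) _ _.
Next Obligation. by move=> s t k x y; rewrite /= !opP. Qed.
Next Obligation.
move=> s t; exists (opnorm s * opnorm t) => x /=.
by rewrite (le_trans (ler_opnorm _ _))// -mulrA ler_wpM2l ?opnorm_ge0 ?ler_opnorm.
Qed.

Program Definition op_id := @BoundedOp id _ _.
Next Obligation. by []. Qed.
Next Obligation. by exists 1 => x; rewrite mul1r. Qed.

Let op_addA : associative op_add.
Proof. by move=> s t u; apply: boundedOpP => x /=; rewrite addrA. Qed.
Let op_addC : commutative op_add.
Proof. by move=> s t; apply: boundedOpP => x /=; rewrite addrC. Qed.
Let op_add0 : left_id op_zero op_add.
Proof. by move=> t; apply: boundedOpP => x /=; rewrite add0r. Qed.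
Let op_addN : left_inverse op_zero op_opp op_add.
Proof. by move=> t; apply: boundedOpP => x /=; rewrite addNr. Qed.

HB.instance Definition _ :=
  GRing.isZmodule.Build boundedOp op_addA op_addC op_add0 op_addN.

Let op_scaleA (k l : K) t : op_scale k (op_scale l t) = op_scale (k * l) t.
Proof. by apply: boundedOpP => x /=; rewrite scalerA. Qed.
Let op_scale1 : left_id 1 op_scale.
Proof. by move=> t; apply: boundedOpP => x /=; rewrite scale1r. Qed.
Let op_scaleDr : right_distributive op_scale +%R.
Proof. by move=> k s t; apply: boundedOpP => x /=; rewrite scalerDr. Qed.
Let op_scaleDl t : {morph op_scale^~ t : k l / k + l}.
Proof. by move=> k l; apply: boundedOpP => x /=; rewrite scalerDl. Qed.

HB.instance Definition _ := GRing.Zmodule_isLmodule.Build K boundedOp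
  op_scaleA op_scale1 op_scaleDr op_scaleDl.

Let opnormD s t : opnorm (s + t) <= opnorm s + opnorm t.
Proof.
apply: opnorm_le => [|x]; first by rewrite addr_ge0// opnorm_ge0.
by rewrite mulrDl (le_trans (ler_normD _ _))// lerD// ler_opnorm.
Qed.

Let opnormZ (k : K) t : opnorm (k *: t) = `|k| * opnorm t.
Proof.
have leZ (l : K) s : opnorm (l *: s) <= `|l| * opnorm s.
  apply: opnorm_le => [|x]; first by rewrite mulr_ge0// opnorm_ge0.
  by rewrite normrZ -mulrA ler_wpM2l// ler_opnorm.
apply/eqP; rewrite eq_le leZ /=.
have [->|k0] := eqVneq k 0; first by rewrite normr0 mul0r opnorm_ge0.
rewrite -ler_pdivlMl ?normr_gt0// -normfV.
by rewrite -{1}[t](scalerK k0) leZ.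
Qed.

Let opnorm_eq0 t : opnorm t = 0 -> t = 0.
Proof.
move=> t0; apply: boundedOpP => x; apply/eqP.
by rewrite -normr_le0 (le_trans (ler_opnorm _ _))// t0 mul0r.
Qed.

HB.instance Definition _ :=
  Lmodule_isNormed.Build K boundedOp opnormD opnormZ opnorm_eq0.

Lemma op_addE s t x : (s + t) x = s x + t x. Proof. by []. Qed.
Lemma op_subE s t x : (s - t) x = s x - t x. Proof. by []. Qed.
Lemma op_scaleE (k : K) t x : (k *: t) x = k *: t x. Proof. by []. Qed.

Lemma op_normE t : `|t| = opnorm t. Proof. by []. Qed.

Lemma ler_norm_op t x : `|t x| <= `|t| * `|x|.
Proof. exact: ler_opnorm. Qed.

Let op_complete (F : set_system boundedOp) :
  ProperFilter F -> cauchy F -> cvg F.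
Proof.
move=> FF Fc; have FA e : 0 < e ->
    exists2 A, F A & forall s t, A s -> A t -> `|s - t| < e.
  move=> e0; have /cauchy_ballP/(_ e e0) [[A B] /= [FA FB] AB] := Fc.
  exists (A `&` B); first exact: filterI.
  move=> s t [As _] [_ Bt].
  by have /= := AB (s, t) (conj As Bt); rewrite -ball_normE.
have cF x : cvg ((fun t => t x) @ F).
  apply: cauchy_cvg; apply/cauchyP => e e0.
  have x1 : 0 < `|x| + 1 by rewrite ltr_wpDl.
  have [A FA' Ae] := FA (e / (`|x| + 1)) (divr_gt0 e0 x1).
  have [s As] := filter_ex FA'; exists (s x).
  suff : F [set t : boundedOp | `|s x - t x| < e] by rewrite -ball_normE.
  apply: filterS FA' => t At /=; rewrite -op_subE.
  rewrite (le_lt_trans (ler_norm_op _ _))//.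
  rewrite (@le_lt_trans _ _ (`|s - t| * (`|x| + 1)))//.
    by rewrite ler_wpM2l// lerDl.
  by rewrite -ltr_pdivlMr// Ae.
pose T x := lim ((fun t => t x) @ F).
have FT x : (fun t => t x) @ F --> T x by exact: cF.
have Tlin : linear T.
  move=> k x y; apply: cvg_lim => //.
  rewrite (_ : (fun t => _) = (fun t : boundedOp => k *: t x + t y)); last first.
    by apply/funext => t; rewrite opP.
  by apply: cvgD (FT y); apply: cvgZ (FT x); exact: cvg_cst.
have le_lim e A s x : F A -> (forall s t, A s -> A t -> `|s - t| < e) -> A s ->
    `|s x - T x| <= e * `|x|.
  move=> FA' Ae As.
  have e0 : 0 <= e by rewrite ltW// (le_lt_trans _ (Ae _ _ As As)).
  apply/ler_addgt0Pr => d d0.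
  have /cvgrPdist_lt/(_ d d0) Fd := FT x.
  have [t [At /= Ttd]] := filter_ex (filterI FA' Fd).
  rewrite -(subrKA (t x)) (le_trans (ler_normD _ _))// lerD//.
    rewrite -op_subE (le_trans (ler_norm_op _ _))// ler_wpM2r// ltW//.
    exact: Ae.
  by rewrite distrC ltW.
have [A1 FA1 A1e] := FA 1 ltr01; have [s1 As1] := filter_ex FA1.
have Tbd : exists c : K, forall x, `|T x| <= c * `|x|.
  exists (1 + `|s1|) => x; rewrite -[T x](subrK (s1 x)) mulrDl.
  rewrite (le_trans (ler_normD _ _))// lerD ?ler_norm_op// distrC.
  exact: le_lim A1e As1.
apply/cvg_ex; exists (BoundedOp Tlin Tbd); apply/cvgrPdist_le => e e0.
have [A FA' Ae] := FA e e0; apply: (filterS _ FA') => s As.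
rewrite distrC; apply: opnorm_le; first exact: ltW.
by move=> x; exact: (le_lim _ _ s x FA' Ae As).
Qed.

HB.instance Definition _ := Uniform_isComplete.Build boundedOp op_complete.

Let op_compA : associative op_comp.
Proof. by move=> s t u; apply: boundedOpP. Qed.
Let op_compDl : left_distributive op_comp +%R.
Proof. by move=> s t u; apply: boundedOpP. Qed.
Let op_compDr : right_distributive op_comp +%R.
Proof. by move=> s t u; apply: boundedOpP => x /=; rewrite opD. Qed.
Let op_compZl (k : K) s t : op_comp (k *: s) t = k *: op_comp s t.
Proof. exact: boundedOpP. Qed.
Let op_compZr (k : K) s t : op_comp s (k *: t) = k *: op_comp s t.
Proof. by apply: boundedOpP => x /=; rewrite opZ. Qed.
Let ler_opnorm_comp s t : `|op_comp s t| <= `|s| * `|t|.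
Proof.
apply: opnorm_le => [|x /=]; first by rewrite mulr_ge0.
by rewrite (le_trans (ler_norm_op _ _))// -mulrA ler_wpM2l// ler_norm_op.
Qed.

HB.instance Definition _ := CompleteNormedModule_isBanachAlgebra.Build K
  boundedOp op_compA op_compDl op_compDr op_compZl op_compZr ler_opnorm_comp.

End BoundedOperators.


Section Multipliers.
Variables (K : realOrComplexType) (A : banachAlgType K).

Record multiplier := Multiplier {
  lmult : boundedOp A;
  rmult : boundedOp A;
  lmult_bmul : forall a b, lmult (a ** b) = lmult a ** b;
  rmult_bmul : forall a b, rmult (a ** b) = a ** rmult b;
  bmul_lmult : forall a b, a ** lmult b = rmult a ** b
}.

HB.instance Definition _ := gen_eqMixin multiplier.
HB.instance Definition _ := gen_choiceMixin multiplier.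

Implicit Types m n p : multiplier.

Lemma multiplierP m n : lmult m = lmult n -> rmult m = rmult n -> m = n.
Proof.
case: m => lm rm a1 a2 a3; case: n => ln rn b1 b2 b3 /= elmn ermn.
by subst; congr Multiplier; exact: Prop_irrelevance.
Qed.

Let bmul0l (a : A) : 0 ** a = 0.
Proof. by rewrite -{1}(scale0r (0 : A)) bmulZl scale0r. Qed.
Let bmul0r (a : A) : a ** 0 = 0.
Proof. by rewrite -{1}(scale0r (0 : A)) bmulZr scale0r. Qed.
Let bmulNl (a b : A) : (- a) ** b = - (a ** b).
Proof. by rewrite -scaleN1r bmulZl scaleN1r. Qed.
Let bmulNr (a b : A) : a ** (- b) = - (a ** b).
Proof. by rewrite -scaleN1r bmulZr scaleN1r. Qed.

Program Definition mult_zero := @Multiplier 0 0 _ _ _.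
Next Obligation. by move=> a b /=; rewrite bmul0l. Qed.
Next Obligation. by move=> a b /=; rewrite bmul0r. Qed.
Next Obligation. by move=> a b /=; rewrite bmul0l bmul0r. Qed.

Program Definition mult_opp m := @Multiplier (- lmult m) (- rmult m) _ _ _.
Next Obligation. by move=> m a b /=; rewrite lmult_bmul bmulNl. Qed.
Next Obligation. by move=> m a b /=; rewrite rmult_bmul bmulNr. Qed.
Next Obligation. by move=> m a b /=; rewrite bmulNl bmulNr bmul_lmult. Qed.

Program Definition mult_add m n :=
  @Multiplier (lmult m + lmult n) (rmult m + rmult n) _ _ _.
Next Obligation. by move=> m n a b /=; rewrite !lmult_bmul bmulDl. Qed.
Next Obligation. by move=> m n a b /=; rewrite !rmult_bmul bmulDr. Qed.
Next Obligation. by move=> m n a b /=; rewrite bmulDl bmulDr !bmul_lmult. Qed.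

Program Definition mult_scale (k : K) m :=
  @Multiplier (k *: lmult m) (k *: rmult m) _ _ _.
Next Obligation. by move=> k m a b /=; rewrite lmult_bmul bmulZl. Qed.
Next Obligation. by move=> k m a b /=; rewrite rmult_bmul bmulZr. Qed.
Next Obligation. by move=> k m a b /=; rewrite bmulZl bmulZr bmul_lmult. Qed.

Program Definition mult_mul m n :=
  @Multiplier (lmult m ** lmult n) (rmult n ** rmult m) _ _ _.
Next Obligation. by move=> m n a b /=; rewrite !lmult_bmul. Qed.
Next Obligation. by move=> m n a b /=; rewrite !rmult_bmul. Qed.
Next Obligation. by move=> m n a b /=; rewrite !bmul_lmult. Qed.

Program Definition mult_one := @Multiplier (op_id A) (op_id A) _ _ _.
Next Obligation. by []. Qed.
Next Obligation. by []. Qed.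
Next Obligation. by []. Qed.

Let mult_addA : associative mult_add.
Proof. by move=> m n p; apply: multiplierP; exact: addrA. Qed.
Let mult_addC : commutative mult_add.
Proof. by move=> m n; apply: multiplierP; exact: addrC. Qed.
Let mult_add0 : left_id mult_zero mult_add.
Proof. by move=> m; apply: multiplierP; exact: add0r. Qed.
Let mult_addN : left_inverse mult_zero mult_opp mult_add.
Proof. by move=> m; apply: multiplierP; exact: addNr. Qed.

HB.instance Definition _ :=
  GRing.isZmodule.Build multiplier mult_addA mult_addC mult_add0 mult_addN.

Let mult_scaleA (k l : K) m :
  mult_scale k (mult_scale l m) = mult_scale (k * l) m.
Proof. by apply: multiplierP; exact: scalerA. Qed.
Let mult_scale1 : left_id 1 mult_scale.
Proof. by move=> m; apply: multiplierP; exact: scale1r. Qed.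
Let mult_scaleDr : right_distributive mult_scale +%R.
Proof. by move=> k m n; apply: multiplierP; exact: scalerDr. Qed.
Let mult_scaleDl m : {morph mult_scale^~ m : k l / k + l}.
Proof. by move=> k l; apply: multiplierP; exact: scalerDl. Qed.

HB.instance Definition _ := GRing.Zmodule_isLmodule.Build K multiplier
  mult_scaleA mult_scale1 mult_scaleDr mult_scaleDl.

Definition mult_norm m : K := Num.max `|lmult m| `|rmult m|.

Let mult_norm_cmp m : (`|lmult m| >=< `|rmult m|)%R.
Proof. by rewrite real_comparable// normr_real. Qed.

Lemma mult_norm_le m c :
  (mult_norm m <= c) = (`|lmult m| <= c) && (`|rmult m| <= c).
Proof. exact: comparable_ge_max. Qed.

Lemma le_lmult_norm m : `|lmult m| <= mult_norm m.
Proof. by rewrite comparable_le_max// lexx. Qed.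

Lemma le_rmult_norm m : `|rmult m| <= mult_norm m.
Proof. by rewrite comparable_le_max// lexx orbT. Qed.

Let mult_norm_ge0 m : 0 <= mult_norm m.
Proof. by rewrite (le_trans _ (le_lmult_norm m)). Qed.

Let mult_normD m n : mult_norm (m + n) <= mult_norm m + mult_norm n.
Proof.
rewrite mult_norm_le !(le_trans (ler_normD _ _)) ?lerD//.
- exact: le_rmult_norm.
- exact: le_rmult_norm.
- exact: le_lmult_norm.
- exact: le_lmult_norm.
Qed.

Let mult_normZ (k : K) m : mult_norm (k *: m) = `|k| * mult_norm m.
Proof.
have leZ (l : K) n : mult_norm (l *: n) <= `|l| * mult_norm n.
  rewrite mult_norm_le !normrZ !ler_wpM2l//.
    exact: le_rmult_norm.
  exact: le_lmult_norm.
apply/eqP; rewrite eq_le leZ /=.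
have [->|k0] := eqVneq k 0; first by rewrite normr0 mul0r mult_norm_ge0.
rewrite -ler_pdivlMl ?normr_gt0// -normfV.
by rewrite -{1}[m](scalerK k0) leZ.
Qed.

Let mult_norm_eq0 m : mult_norm m = 0 -> m = 0.
Proof.
move=> m0; apply: multiplierP; apply/eqP; rewrite -normr_le0 -m0.
  exact: le_lmult_norm.
exact: le_rmult_norm.
Qed.

HB.instance Definition _ :=
  Lmodule_isNormed.Build K multiplier mult_normD mult_normZ mult_norm_eq0.

Let mult_complete (F : set_system multiplier) :
  ProperFilter F -> cauchy F -> cvg F.
Proof.
move=> FF Fc.
have lip_l m n : `|lmult m - lmult n| <= 1 * `|m - n|.
  by rewrite mul1r; exact: (le_lmult_norm (m - n)).
have lip_r m n : `|rmult m - rmult n| <= 1 * `|m - n|.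
  by rewrite mul1r; exact: (le_rmult_norm (m - n)).
have /cvg_ex[L FL] : cvg (lmult @ F).
  by apply: cauchy_cvg; exact: (lip_cauchy ler01 lip_l).
have /cvg_ex[R FR] : cvg (rmult @ F).
  by apply: cauchy_cvg; exact: (lip_cauchy ler01 lip_r).
have lip_ev x (s t : boundedOp A) : `|s x - t x| <= `|x| * `|s - t|.
  by rewrite -op_subE mulrC ler_norm_op.
have lip_ml a (x y : A) : `|a ** x - a ** y| <= `|a| * `|x - y|.
  by rewrite -bmulNr -bmulDr ler_norm_bmul.
have lip_mr a (x y : A) : `|x ** a - y ** a| <= `|a| * `|x - y|.
  by rewrite -bmulNl -bmulDl mulrC ler_norm_bmul.
have FLx x : (fun m => lmult m x) @ F --> L x.
  exact: (lip_cvg (normr_ge0 x) (lip_ev x) _ FL).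
have FRx x : (fun m => rmult m x) @ F --> R x.
  exact: (lip_cvg (normr_ge0 x) (lip_ev x) _ FR).
have FF' : Filter F by exact: filter_filter.
have Lbmul a b : L (a ** b) = L a ** b.
  have := lip_cvg (normr_ge0 b) (lip_mr b) FF' (FLx a).
  under eq_fun do rewrite -lmult_bmul.
  by move=> lim2; exact: (norm_cvg_unique (FLx _) lim2).
have Rbmul a b : R (a ** b) = a ** R b.
  have := lip_cvg (normr_ge0 a) (lip_ml a) FF' (FRx b).
  under eq_fun do rewrite -rmult_bmul.
  by move=> lim2; exact: (norm_cvg_unique (FRx _) lim2).
have LR a b : a ** L b = R a ** b.
  have := lip_cvg (normr_ge0 a) (lip_ml a) FF' (FLx b).
  under eq_fun do rewrite bmul_lmult.
  have := lip_cvg (normr_ge0 b) (lip_mr b) FF' (FRx a).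
  by move=> limR limL; exact: (norm_cvg_unique limL limR).
apply/cvg_ex; exists (Multiplier Lbmul Rbmul LR); apply/cvgrPdist_le => e e0.
have /cvgrPdist_le/(_ e e0) FLe := FL.
have /cvgrPdist_le/(_ e e0) FRe := FR.
apply: filterS (filterI FLe FRe) => m [le_l le_r].
suff : mult_norm (Multiplier Lbmul Rbmul LR - m) <= e by [].
by rewrite mult_norm_le; apply/andP.
Qed.

HB.instance Definition _ := Uniform_isComplete.Build multiplier mult_complete.

Let mult_mulA : associative mult_mul.
Proof. by move=> m n p; apply: multiplierP; rewrite /= bmulA. Qed.
Let mult_mulDl : left_distributive mult_mul +%R.
Proof.
by move=> m n p; apply: multiplierP => /=; rewrite (bmulDl, bmulDr).
Qed.
Let mult_mulDr : right_distributive mult_mul +%R.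
Proof.
by move=> m n p; apply: multiplierP => /=; rewrite (bmulDl, bmulDr).
Qed.
Let mult_mulZl (k : K) m n : mult_mul (k *: m) n = k *: mult_mul m n.
Proof. by apply: multiplierP => /=; rewrite (bmulZl, bmulZr). Qed.
Let mult_mulZr (k : K) m n : mult_mul m (k *: n) = k *: mult_mul m n.
Proof. by apply: multiplierP => /=; rewrite (bmulZl, bmulZr). Qed.
Let ler_mult_norm_mul m n : `|mult_mul m n| <= `|m| * `|n|.
Proof.
suff : mult_norm (mult_mul m n) <= mult_norm m * mult_norm n by [].
rewrite mult_norm_le; apply/andP.
split; apply: (le_trans (ler_norm_bmul _ _)).
  by apply: ler_pM => //; exact: le_lmult_norm.
by rewrite mulrC; apply: ler_pM => //; exact: le_rmult_norm.
Qed.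

HB.instance Definition _ := CompleteNormedModule_isBanachAlgebra.Build K
  multiplier mult_mulA mult_mulDl mult_mulDr mult_mulZl mult_mulZr
  ler_mult_norm_mul.

Program Definition lmul_op (a : A) := @BoundedOp K A (fun b => a ** b) _ _.
Next Obligation. by move=> a k b c; rewrite bmulDr bmulZr. Qed.
Next Obligation. by move=> a; exists `|a| => b; exact: ler_norm_bmul. Qed.

Program Definition rmul_op (a : A) := @BoundedOp K A (fun b => b ** a) _ _.
Next Obligation. by move=> a k b c; rewrite bmulDl bmulZl. Qed.
Next Obligation.
by move=> a; exists `|a| => b; rewrite mulrC; exact: ler_norm_bmul.
Qed.

Program Definition iota_mult (a : A) := @Multiplier (lmul_op a) (rmul_op a) _ _ _.
Next Obligation. by move=> a b c /=; rewrite bmulA. Qed.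
Next Obligation. by move=> a b c /=; rewrite bmulA. Qed.
Next Obligation. by move=> a b c /=; rewrite bmulA. Qed.

End Multipliers.

Section ApproximateIdentity.
Variables (K : numFieldType) (A : banachAlgType K).

Definition directed (I : Type) (le : I -> I -> Prop) :=
  [/\ exists i : I, True, forall i, le i i,
      forall i j k, le i j -> le j k -> le i k &
      forall i j, exists k, le i k /\ le j k].

(* Convergence along this filter is convergence of nets indexed by (I, le). *)
Definition net_filter (I : Type) (le : I -> I -> Prop) : set_system I :=
  [set S | exists i0, forall i, le i0 i -> S i].

Definition contractive_approximate_identity
    (I : Type) (le : I -> I -> Prop) (e : I -> A) :=
  [/\ directed le,
      forall i, `|e i| <= 1,
      forall a, (`|a ** e i - a| : K^o) @[i --> net_filter le] --> (0 : K^o) &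
      forall a, (`|e i ** a - a| : K^o) @[i --> net_filter le] --> (0 : K^o)].

Definition has_contractive_approximate_identity :=
  exists (I : Type) (le : I -> I -> Prop) (e : I -> A),
    contractive_approximate_identity le e.

End ApproximateIdentity.

Section TwoSidedMultipliers.
Variables (K : numFieldType) (B : banachAlgType K).

Definition two_sided_multipliers (C : set B) : set B :=
  [set t | (forall s, C s -> C (t ** s)) /\ (forall s, C s -> C (s ** t))].

End TwoSidedMultipliers.

Section LinearSpan.
Variables (K : numFieldType) (V : lmodType K).

Definition linear_span (S : set V) : set V :=
  [set x | exists (n : nat) (c : 'I_n -> K) (v : 'I_n -> V),
    (forall i, S (v i)) /\ x = \sum_(i < n) c i *: v i].

End LinearSpan.

Section AlgebraHomomorphisms.
Variables (K : numFieldType) (A B : banachAlgType K).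
Implicit Types f : A -> B.

Definition algebra_hom f := linear f /\ {morph f : a b / a ** b}.
Definition contractive f := forall a, `|f a| <= `|a|.
Definition isometric f := forall a, `|f a| = `|a|.
Definition isometric_isomorphism_onto f (C : set B) :=
  [/\ algebra_hom f, isometric f & range f = C].

End AlgebraHomomorphisms.

Section Representations.
Variables (K : realOrComplexType) (A : banachAlgType K).
Variable E : completeNormedModType K.

Definition representation (pi : A -> boundedOp E) :=
  algebra_hom pi /\ continuous pi.

Definition nondegenerate_rep (pi : A -> boundedOp E) :=
  dense (linear_span [set pi a x | a in [set: A] & x in [set: E]]).

Definition unital (rho : multiplier A -> boundedOp E) :=
  rho (mult_one A) = op_id E.

End Representations.

(* Main.v *)
(* The operator attached to a multiplier [m = (L, R)] is the strong limit [t]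
   of [pi (L e_i)]: on vectors [pi a x] one has [pi (L e_i) (pi a x) =
   pi (L (e_i a)) x], which tends to [pi (L a) x], and the net is bounded by
   the norm of [L]. By nondegeneracy [t] is the only operator with
   [t pi(a) = pi(L a)] for all [a], and this equation is forced on every
   representation extending [pi]. It also gives [pi(a) t = pi(R a)], so when
   [pi] is isometric both [L] and [R] are bounded by the norm of [t].
   Conversely, a two-sided multiplier [t] of [pi(A)] induces the multiplier
   [a |-> pi^-1 (t pi(a))], [a |-> pi^-1 (pi(a) t)]. *)
Require Import Defs.
From mathcomp Require Import all_boot all_order all_algebra.
From mathcomp Require Import all_classical all_reals all_analysis.

Import Order.TTheory GRing.Theory Num.Theory.
Import numFieldNormedType.Exports.

Local Open Scope classical_set_scope.
Local Open Scope ring_scope.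

(** * Spans, dense sets and filters of nets *)

Section LinearSpanTheory.
Context {K : numFieldType} {V : lmodType K}.

Lemma linear_span_ind (S P : set V) : P 0 ->
    (forall k x y, P x -> P y -> P (k *: x + y)) ->
  S `<=` P -> linear_span S `<=` P.
Proof.
move=> P0 Plin SP _ [n [c [v [Sv ->]]]].
elim/big_rec: _ => // i x _ Px; apply: Plin => //; exact: SP.
Qed.

Lemma sub_linear_span (S : set V) : S `<=` linear_span S.
Proof.
move=> x Sx; exists 1%N, (fun=> 1), (fun=> x); split=> //.
by rewrite big_ord1 scale1r.
Qed.

End LinearSpanTheory.

Lemma dense_dist {K : numFieldType} {V : normedModType K} {S : set V} :
  dense S -> forall x e, 0 < e -> exists2 y, S y & `|x - y| < e.
Proof.
move=> Sd x e e0; have [|y [+ Sy]] := Sd _ _ (ball_open x e).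
  by exists x; exact: ballxx.
by rewrite -ball_normE; exists y.
Qed.

Lemma linear_contractive_continuous {K : numFieldType} {A B : banachAlgType K}
    (f : A -> B) : linear f -> contractive f -> continuous f.
Proof.
move=> f_lin f_contr x.
apply: (@lip_cvg _ _ _ f 1 _ _ _ _ _ _ _ cvg_id) => // a b.
by rewrite mul1r addrC -scaleN1r -f_lin scaleN1r addrC.
Qed.

Lemma net_filter_proper (I : Type) (le : I -> I -> Prop) :
  directed le -> ProperFilter (net_filter le).
Proof.
move=> [[i0 _] refl trans dir]; split.
  by move=> [i /(_ i (refl i))].
split; first by exists i0.
- move=> P Q [i Pi] [j Qj]; have [k [ik jk]] := dir i j.
  exists k => l kl; split; [apply: Pi | apply: Qj]; exact: trans kl.
- by move=> P Q PQ [i Pi]; exists i => j /Pi/PQ.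
Qed.

(** * Bounded operators controlled on a set with dense span *)

Section BoundedOpLimits.
Context {K : realOrComplexType} {E : completeNormedModType K}.

Lemma boundedOp_dense_eq (S : set E) (s t : boundedOp E) :
  dense (linear_span S) -> (forall x, S x -> s x = t x) -> s = t.
Proof.
move=> Sd st; have {}st x : linear_span S x -> s x = t x.
  apply: (linear_span_ind S (fun x => s x = t x)) => {x}//.
    by rewrite !op0.
  by move=> k x y; rewrite !opP => -> ->.
apply: boundedOpP => x; apply/eqP; rewrite -subr_eq0 -op_subE -normr_le0.
apply/ler_addgt0Pr => e e0; rewrite add0r.
(* The summand 1 keeps the divisor positive even when [s = t]. *)
have d0 : 0 < `|s - t| + 1 by rewrite ltr_wpDl.
have [y Sy xy] := dense_dist Sd x _ (divr_gt0 e0 d0).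
have st0 : (s - t) y = 0 by rewrite op_subE st// subrr.
rewrite -[x](subrK y) opD st0 addr0.
rewrite (le_trans (ler_norm_op _ _))//.
rewrite (@le_trans _ _ ((`|s - t| + 1) * `|x - y|))//.
  by rewrite ler_wpM2r// lerDl.
by rewrite -ler_pdivlMl// mulrC ltW.
Qed.

(** The uniform bound carries convergence from the dense span to all of [E], where completeness
    supplies the limits; linearity and the bound [c] pass to the limit. *)
Lemma boundedOp_strong_limit (I : Type) (F : set_system I) (T : I -> boundedOp E)
    (c : K) (S : set E) : ProperFilter F -> (forall i, `|T i| <= c) ->
    dense (linear_span S) -> (forall x, S x -> cvg (T i x @[i --> F])) ->
  exists2 t : boundedOp E, `|t| <= c & forall x, T i x @[i --> F] --> t x.
Proof.
move=> FF Tc Sd ST.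
have c0 : 0 <= c.
  by have [i _] := filter_ex (@filterT _ F _); exact: le_trans (Tc i).
have cvgP k x y : cvg (T i x @[i --> F]) -> cvg (T i y @[i --> F]) ->
    cvg (T i (k *: x + y) @[i --> F]).
  move=> Tx Ty.
  have -> : (fun i => T i (k *: x + y)) = (fun i => k *: T i x + T i y).
    by apply/funext => i; rewrite opP.
  by apply: is_cvgD Ty; apply: is_cvgZr.
have {}ST x : linear_span S x -> cvg (T i x @[i --> F]).
  apply: (linear_span_ind S (fun x => cvg (T i x @[i --> F]))) => {x}//.
  have -> : (fun i => T i 0) = fun=> 0 by apply/funext => i; rewrite op0.
  exact: is_cvg_cst.
have cT x : cvg (T i x @[i --> F]).
  apply: cauchy_cvg; apply/cauchyP => e e0.
  have e20 : 0 < e / 2 by rewrite divr_gt0.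
  have c1 : 0 < c + 1 by rewrite ltr_wpDl.
  have [y Sy xy] := dense_dist Sd x _ (divr_gt0 e20 c1).
  (* The limit [l] at the nearby [y] is the centre of the Cauchy ball: half of [e] covers [T i y]
     against [l], half covers [T i x] against [T i y]. *)
  have /cvgrPdist_lt/(_ _ e20) := ST y Sy.
  set l := lim _ => ly; exists l.
  suff : F [set i | `|l - T i x| < e] by rewrite -ball_normE.
  apply: filterS ly => i /= ly; rewrite -(subrKA (T i y)).
  rewrite (le_lt_trans (ler_normD _ _))// [ltRHS](splitr e) ltr_leD//.
  rewrite -opB (le_trans (ler_norm_op _ _))// distrC.
  rewrite (@le_trans _ _ ((c + 1) * `|x - y|))//.
    by rewrite ler_wpM2r// (le_trans (Tc i))// lerDl.
  by rewrite -ler_pdivlMl// mulrC ltW.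
pose t x := lim (T i x @[i --> F]).
have tlin : linear t.
  move=> k x y; apply: cvg_lim => //.
  have -> : (fun i => T i (k *: x + y)) = (fun i => k *: T i x + T i y).
    by apply/funext => i; rewrite opP.
  by apply: cvgD (cT y); apply: cvgZ (cT x); exact: cvg_cst.
have tc x : `|t x| <= c * `|x|.
  apply/ler_addgt0Pr => e e0.
  have /cvgrPdist_lt/(_ _ e0) := cT x => /filter_ex[i /= lti].
  rewrite -[X in `|X|](subrK (T i x)) (le_trans (ler_normD _ _))// addrC.
  rewrite lerD//; last exact: ltW.
  by rewrite (le_trans (ler_norm_op _ _))// ler_wpM2r.
exists (BoundedOp tlin (ex_intro _ c tc)); last exact: cT.
by rewrite op_normE; exact: opnorm_le.
Qed.

End BoundedOpLimits.

(** * Multipliers of [A] against operators on [E] *)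

Section MultiplierRepresentation.
Context {K : realOrComplexType} {A : banachAlgType K}.
Context {E : completeNormedModType K}.

(** Only the left component appears; the matching equation for [rmult m] follows in
    [implements_rmult]. *)
Definition implements (pi : A -> boundedOp E) (m : multiplier A)
    (t : boundedOp E) := forall a, t ** pi a = pi (lmult m a).

Context { pi : A -> boundedOp E}.
Hypothesis pi_hom : algebra_hom pi.
Hypothesis pi_isometric : isometric pi.
Hypothesis pi_nondegenerate : nondegenerate_rep pi.
Implicit Types (m n : multiplier A) (s t : boundedOp E).

Let piP (k : K) a b : pi (k *: a + b) = k *: pi a + pi b.
Proof. by have [+ _] := pi_hom; apply. Qed.

Let piB a b : pi (a - b) = pi a - pi b.
Proof. by rewrite addrC -scaleN1r piP scaleN1r addrC. Qed.

Let piM a b : pi (a ** b) = pi a ** pi b.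
Proof. by have [_] := pi_hom; apply. Qed.

Let pi_inj : injective pi.
Proof.
move=> a b ab; apply/eqP; rewrite -subr_eq0 -normr_eq0 -pi_isometric piB ab.
by rewrite subrr normr0.
Qed.

Lemma nondegenerate_rep_eq s t :
  (forall a, s ** pi a = t ** pi a) -> s = t.
Proof.
move=> st; apply: boundedOp_dense_eq pi_nondegenerate _ => _ [a _ [x _ <-]].
by have /(congr1 (fun u : boundedOp E => u x)) := st a.
Qed.

Lemma implements_unique m s t : implements pi m s -> implements pi m t -> s = t.
Proof. by move=> ms mt; apply: nondegenerate_rep_eq => a; rewrite ms mt. Qed.

(** Multiplied on the right by [pi b], both sides become [pi (a ** lmult m b) = pi (rmult m a **
    b)]. *)
Lemma implements_rmult m t a : implements pi m t -> pi a ** t = pi (rmult m a).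
Proof.
move=> mt; apply: nondegenerate_rep_eq => b.
by rewrite -bmulA mt -!piM bmul_lmult.
Qed.

Lemma multiplier_norm_le m t : implements pi m t -> `|m| <= `|t|.
Proof.
move=> mt; rewrite [`|m|]/(mult_norm m) mult_norm_le; apply/andP.
split; apply: opnorm_le => // a; rewrite -pi_isometric.
  by rewrite -mt (le_trans (ler_norm_bmul _ _))// pi_isometric.
rewrite -(implements_rmult _ _ _ mt) (le_trans (ler_norm_bmul _ _))//.
by rewrite pi_isometric mulrC.
Qed.

Lemma exists_implements m : has_contractive_approximate_identity A ->
  exists2 t, implements pi m t & `|t| <= `|m|.
Proof.
move=> [I [le [e [/net_filter_proper FF e1 _ ea]]]].
set F := net_filter le in FF ea.
have eaF a : e i ** a @[i --> F] --> a.
  apply/cvgrPdist_lt => d d0; have /cvgrPdist_lt/(_ d d0) := ea a.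
  by apply: filterS => i; rewrite sub0r normrN normr_id distrC.
have lim a x : pi (lmult m (e i)) (pi a x) @[i --> F] --> pi (lmult m a) x.
  have -> : (fun i => pi (lmult m (e i)) (pi a x)) =
      (fun i => pi (lmult m (e i ** a)) x).
    by apply/funext => i; rewrite lmult_bmul piM.
  (* [phi] is Lipschitz, so it preserves the limit of [e i ** a]. *)
  pose phi b := pi (lmult m b) x.
  apply: (@lip_cvg _ _ _ phi (`|lmult m| * `|x|)) (eaF a) => [|b c].
    by rewrite mulr_ge0.
  rewrite /phi -op_subE -piB -opB (le_trans (ler_norm_op _ _))// pi_isometric.
  by rewrite mulrAC ler_wpM2r// ler_norm_op.
have [|_ [a _ [x _ <-]]|t tm tlim] :=
    boundedOp_strong_limit _ F (fun i => pi (lmult m (e i))) `|m| _ FF _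
      pi_nondegenerate.
- move=> i; rewrite pi_isometric (le_trans (ler_norm_op _ _))//.
  rewrite -[leRHS]mulr1 ler_pM//; exact: le_lmult_norm.
- by apply/cvg_ex; exists (pi (lmult m a) x); exact: lim.
exists t => // a; apply: boundedOpP => x.
exact: (norm_cvg_unique (tlim (pi a x)) (lim a x)).
Qed.

(** Since [pi] is injective, the multiplier identities for the chosen preimages may be checked after
    applying [pi], where they reduce to associativity. *)
Lemma two_sided_multiplier_implements t :
  two_sided_multipliers (range pi) t -> exists m, implements pi m t.
Proof.
move=> [tl tr].
have /choice[L piL] a : exists b, pi b = t ** pi a.
  by have [|b _ <-] := tl (pi a); [exists a | exists b].
have /choice[R piR] a : exists b, pi b = pi a ** t.
  by have [|b _ <-] := tr (pi a); [exists a | exists b].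
have Llin : linear L.
  by move=> k a b; apply: pi_inj; rewrite piP !piL piP bmulDr bmulZr.
have Rlin : linear R.
  by move=> k a b; apply: pi_inj; rewrite piP !piR piP bmulDl bmulZl.
(* Isometry of [pi] transports the bound [|t|] back to [A]. *)
have Lb : exists c : K, forall a, `|L a| <= c * `|a|.
  by exists `|t| => a; rewrite -!pi_isometric piL ler_norm_bmul.
have Rb : exists c : K, forall a, `|R a| <= c * `|a|.
  by exists `|t| => a; rewrite mulrC -!pi_isometric piR ler_norm_bmul.
have Lmul a b : BoundedOp Llin Lb (a ** b) = BoundedOp Llin Lb a ** b.
  by apply: pi_inj; rewrite /= piM !piL piM bmulA.
have Rmul a b : BoundedOp Rlin Rb (a ** b) = a ** BoundedOp Rlin Rb b.
  by apply: pi_inj; rewrite /= piM !piR piM bmulA.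
have LR a b : a ** BoundedOp Llin Lb b = BoundedOp Rlin Rb a ** b.
  by apply: pi_inj; rewrite /= !piM piL piR bmulA.
by exists (Multiplier Lmul Rmul LR) => a; rewrite -piL.
Qed.

End MultiplierRepresentation.

(** This makes the image of [A] a left ideal of [multiplier A], which is what determines an
    extension of [pi]; the right components agree by [bmul_lmult]. *)
Lemma mult_mul_iota {K : realOrComplexType} {A : banachAlgType K}
    (m : multiplier A) (a : A) : m ** iota_mult a = iota_mult (lmult m a).
Proof.
apply: multiplierP; apply: boundedOpP => b /=; first by rewrite lmult_bmul.
by rewrite bmul_lmult.
Qed.

Theorem corollary3p6 (K : realOrComplexType) (A : banachAlgType K)
    (E : completeNormedModType K) (pi : A -> boundedOp E)
    (A_cai : has_contractive_approximate_identity A)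
    (pi_rep : representation pi) (pi_isometric : isometric pi)
    (pi_nondegenerate : nondegenerate_rep pi) :
  exists pihat : multiplier A -> boundedOp E,
    unique (fun rho : multiplier A -> boundedOp E =>
      [/\ representation rho, nondegenerate_rep rho, contractive rho,
          unital rho & rho \o @iota_mult K A = pi]) pihat /\
    isometric_isomorphism_onto pihat (two_sided_multipliers (range pi)).
Proof.
have [pi_hom _] := pi_rep; have [pi_lin piM] := pi_hom.
have /choice[rho rhoP] m : exists t, implements pi m t /\ `|t| <= `|m|.
  have [t] := exists_implements pi_hom pi_isometric pi_nondegenerate m A_cai.
  by exists t.
have rho_impl m : implements pi m (rho m) by have [] := rhoP m.
have rho_contr : contractive rho by move=> m; have [] := rhoP m.
(* [rho] is chosen pointwise; uniqueness of the implementing operator turns each algebraic law for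
   [rho] into a check of the defining equation. *)
have rho_eq m t : implements pi m t -> rho m = t.
  exact: implements_unique pi_nondegenerate _ _ _ (rho_impl m).
have rho_hom : algebra_hom rho.
  split=> [k m n|m n]; apply: rho_eq => a.
    by rewrite bmulDl bmulZl !rho_impl -pi_lin.
  by rewrite -bmulA !rho_impl.
have rho_cont : continuous rho.
  by have [rho_lin _] := rho_hom; exact: linear_contractive_continuous.
have rho_unital : unital rho by apply: rho_eq => a; exact: boundedOpP.
exists rho; split; last first.
  split=> // [m|].
    by apply/eqP; rewrite eq_le rho_contr (multiplier_norm_le (pi := pi)).
  apply/seteqP; split=> [_ [m _ <-]|t].
    split=> _ [a _ <-]; first by rewrite rho_impl; exists (lmult m a).
    exists (rmult m a) => //.
    by rewrite (implements_rmult pi_hom pi_nondegenerate _ _ _ (rho_impl m)).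
  move=> /(two_sided_multiplier_implements pi_hom pi_isometric)[m mt].
  by exists m => //; exact: rho_eq.
split; first split=> //.
(* As [rho] is unital, [x = rho 1 x], so the span is all of [E]. *)
- move=> O [x Ox] _; exists x; split=> //; apply: sub_linear_span.
  by exists (mult_one A) => //; exists x => //; rewrite rho_unital.
- by apply/funext => a; apply: rho_eq => b; rewrite -piM.
(* With [m = (L, R)], [sigma m ** pi a = sigma (m ** iota_mult a) = sigma (iota_mult (L a)) = pi (L
   a)], so [sigma m] implements [m]. *)
move=> sigma [[[_ sigmaM] _] _ _ _ sigma_iota]; apply/funext => m.
apply: rho_eq => a.
by rewrite -sigma_iota /= -mult_mul_iota sigmaM.
Qed.
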